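(* Let $S$ be a set of $n$ points in the plane in convex position. Then the number of non-crossing path partitions (ncp partitions) that $S$ admits is $\mathcal{O}^*(5.610718614^n)$.
   Context: A non-crossing graph on a finite point set $S$ in the plane is a graph with vertex set $S$ whose edges are straight line segments, no two of which cross. A non-crossing path partition (ncp partition) of $S$ is a non-crossing graph on $S$ every connected component of which is a path; isolated vertices (singletons) are allowed and are regarded as paths of length $0$. The notation $\mathcal{O}^*(c^n)$ means $O(p(n)\,c^n)$ for some polynomial $p$, i.e. polynomial factors are neglected and only the dominating exponential term is given. *)

(* Defs.v *)
From mathcomp Require Import all_boot all_order all_algebra.
From mathcomp Require Import boolp reals.
Set Implicit Arguments. Unset Strict Implicit. Unset Printing Implicit Defensive.
Import Order.TTheory GRing.Theory Num.Theory.
Local Open Scope ring_scope.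

Section Defs.
Variable R : realType.
Variable n : nat.
Variable P : 'I_n -> R * R.

Definition on_segment (p q x : R * R) : Prop :=
  exists t : R, 0 <= t <= 1 /\
    x = ((1 - t) * p.1 + t * q.1, (1 - t) * p.2 + t * q.2).

Definition in_hull_of_others (i : 'I_n) : Prop :=
  exists w : 'I_n -> R,
    (forall j, 0 <= w j) /\ w i = 0 /\ \sum_j w j = 1 /\
    \sum_j w j * (P j).1 = (P i).1 /\ \sum_j w j * (P j).2 = (P i).2.

Definition convex_position : Prop := forall i, ~ in_hull_of_others i.

(* Graphs on vertex set 'I_n are given by their edge sets
   E : {set {set 'I_n}} (an edge is the 2-element set of its endpoints). *)

Definition edges_cross (a b c d : 'I_n) : Prop :=
  exists x, on_segment (P a) (P b) x /\ on_segment (P c) (P d) x /\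
    ~ (exists v, v \in [set a; b] :&: [set c; d] /\ x = P v).

Definition non_crossing (E : {set {set 'I_n}}) : Prop :=
  forall a b c d : 'I_n, [set a; b] \in E -> [set c; d] \in E ->
    [set a; b] != [set c; d] -> ~ edges_cross a b c d.

(* every connected component is a path (singletons allowed): the vertex set
   splits into vertex-disjoint sequences (ss partitions 'I_n) and the edges
   are exactly the pairs of consecutive vertices in these sequences *)
Definition path_partition_graph (E : {set {set 'I_n}}) : Prop :=
  exists ss : seq (seq 'I_n),
    perm_eq (flatten ss) (enum 'I_n) /\
    forall e, e \in E <->
      exists2 s, s \in ss &
        exists (x y : 'I_n) (s1 s2 : seq 'I_n),
          s = s1 ++ x :: y :: s2 /\ e = [set x; y].

Definition ncp_partition (E : {set {set 'I_n}}) : Prop :=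
  non_crossing E /\ path_partition_graph E.

Definition num_ncp : nat := #|[set E : {set {set 'I_n}} | `[< ncp_partition E >]]|.

End Defs.

(* Main.v *)
Require Import Defs.
From mathcomp Require Import all_boot all_order all_algebra.
From mathcomp Require Import boolp reals.
From mathcomp Require Import ring lra zify.
Set Implicit Arguments. Unset Strict Implicit. Unset Printing Implicit Defensive.
Import Order.TTheory GRing.Theory Num.Theory.

(* Points in convex position, sorted by angle around the lexicographically
   smallest one, are in circular order: segments with interleaving endpoints
   cross.  A non-crossing graph is then recovered by scanning the points in this
   order with a stack of open edges, knowing only how many edges each point
   closes and opens.  For a path partition the open edges of a common path are
   always adjacent in the stack, so the stack is a word in two letters (paths
   with one or two open edges), and a point may not close both ends of a path.
   The number of runs of this automaton is bounded by c^n by means of a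
   supersolution (potential) of its transfer equations. *)

(** * The stack automaton *)

(* A path of the subgraph induced by the vertices scanned so far, seen through
   its one or two edges leading to later vertices. *)
Variant strand (T : Type) := One of T | Two of T & T.

Definition strand_map (T U : Type) (f : T -> U) (x : strand T) : strand U :=
  match x with One a => One (f a) | Two a b => Two (f a) (f b) end.

Definition strand_ends (T : Type) (x : strand T) : seq T :=
  match x with One a => [:: a] | Two a b => [:: a; b] end.

Definition stack_ends (T : Type) (st : seq (strand T)) : seq T :=
  flatten (map (@strand_ends T) st).

(* The edge lists that can be produced by scanning the vertices t, ..., t + k - 1
   when the paths still to be extended are stacked as in st, each open edge
   being represented by its left endpoint.  Non-crossing forces a new vertex to
   be joined to the top of the stack.  The missing transition, where t receives
   both ends of a path Two u1 u2, would close a cycle. *)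
Fixpoint scans (k t : nat) (st : seq (strand nat)) : seq (seq (nat * nat)) :=
  if k is k'.+1 then
    scans k' t.+1 st ++ scans k' t.+1 (One t :: st) ++
    scans k' t.+1 (Two t t :: st) ++
    match st with
    | One u :: r =>
        map (cons (u, t)) (scans k' t.+1 r ++ scans k' t.+1 (One t :: r)) ++
        match r with
        | One u' :: r' => map (cat [:: (u, t); (u', t)]) (scans k' t.+1 r')
        | Two u1 u2 :: r' =>
            map (cat [:: (u, t); (u1, t)]) (scans k' t.+1 (One u2 :: r'))
        | [::] => [::]
        end
    | Two u1 u2 :: r =>
        map (cons (u1, t))
          (scans k' t.+1 (One u2 :: r) ++ scans k' t.+1 (Two t u2 :: r))
    | [::] => [::]
    end
  else if st is [::] then [:: [::]] else [::].

(** * Completeness of the scan *)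

Section Scan.
Variables (n : nat) (e : rel nat) (pos : nat -> nat).
Hypothesis e_lt : forall u v, e u v -> (u < n) /\ (v < n).
Hypothesis e_sym : symmetric e.
(** Together with the injectivity of [pos], this bounds degrees by two and rules out cycles. *)
Hypothesis e_pos : forall u v, e u v -> pos u = (pos v).+1 \/ pos v = (pos u).+1.
Hypothesis pos_inj : {in [pred u | u < n] &, injective pos}.
Hypothesis e_nc : forall a b c d, a < b -> b < c -> c < d -> e a c -> e b d -> False.

Definition open_edges t (L : seq (nat * nat)) :=
  [/\ sorted leq (map snd L), uniq L
    & forall u v, ((u, v) \in L) = [&& u < t, t <= v & e u v]].

Definition right_nbrs t := [seq v <- iota t.+1 (n - t.+1) | e t v].

Lemma mem_right_nbrs t v : (v \in right_nbrs t) = (t < v) && e t v.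
Proof.
rewrite mem_filter mem_iota andbC; case E : (e t v); rewrite ?andbF ?andbT //.
by have [] := e_lt E; lia.
Qed.

Lemma right_nbrs_sorted t : sorted leq (right_nbrs t).
Proof. by apply: sorted_filter (iota_sorted _ _); exact: leq_trans. Qed.

(** The sorting puts the edges that end at [t] first. The size bound is the degree bound at [t]:
    neighbours have distinct positions, each next to [pos t]. *)
Lemma open_edges_split t L : open_edges t L ->
  exists A B, [/\ L = A ++ B, all (fun p => p.2 == t) A,
    all (fun p => t < p.2) B & size A + size (right_nbrs t) <= 2].
Proof.
case=> Lsort Luniq Lmem.
pose A := [seq p <- L | p.2 == t]; pose B := [seq p <- L | t < p.2].
exists A, B; split; rewrite ?filter_all //.
- have : all (fun p => t <= p.2) L.
    by apply/allP => -[u v]; rewrite Lmem => /and3P[].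
  rewrite /A /B; elim: (L) Lsort => //= -[u v] l IH /= Ls /andP[tv Ht].
  have {}IH := IH (path_sorted Ls) Ht.
  move: tv; rewrite leq_eqVlt eq_sym => /orP[/eqP E|lt].
    by rewrite E eqxx ltnn /= -IH.
  rewrite lt (gtn_eqF lt) /= (@eq_in_filter _ _ pred0).
    rewrite filter_pred0 /= (@eq_in_filter _ _ predT) ?filter_predT // => p pl /=.
    have := order_path_min leq_trans Ls => /allP /(_ p.2 (map_f _ pl)) /= H.
    by rewrite (leq_trans lt).
  move=> p pl /=.
  have := order_path_min leq_trans Ls => /allP /(_ p.2 (map_f _ pl)) /= H.
  by rewrite gtn_eqF // (leq_trans lt).
have AP u v : (u, v) \in A -> [/\ v = t, u < t & e u t].
  by rewrite mem_filter Lmem /= => /andP[/eqP-> /and3P[]].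
have nbr u : u \in map fst A ++ right_nbrs t -> e t u.
  rewrite mem_cat => /orP[/mapP[[u' v] /AP[_ _]] + ->|]; first by rewrite e_sym.
  by rewrite mem_right_nbrs => /andP[].
have -> : size A + size (right_nbrs t)
    = size (map pos (map fst A ++ right_nbrs t)).
  by rewrite size_map size_cat size_map.
rewrite (@uniq_leq_size _ _ [:: (pos t).-1; (pos t).+1]) //.
  rewrite map_inj_in_uniq.
    rewrite cat_uniq map_inj_in_uniq ?filter_uniq ?iota_uniq //= ?andbT.
      apply/hasPn => v; rewrite mem_right_nbrs => /andP[tv _].
      by apply/mapP => -[[u w] /AP[_ ut _]] /= E; lia.
    by move=> [u v] [u' v'] /AP[-> _ _] /AP[-> _ _] /= ->.
  move=> u v /nbr Hu /nbr Hv; apply: pos_inj; rewrite inE.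
    by case: (e_lt Hu).
  by case: (e_lt Hv).
move=> p /mapP[u /nbr Hu ->]; rewrite !inE.
by case: (e_pos Hu) => ->; rewrite ?eqxx ?orbT.
Qed.

(** New edges go on top of the stack: an edge from [t] reaching beyond the right endpoint of an
    older open edge would cross it. *)
Lemma open_edges_next t A B : open_edges t (A ++ B) ->
  all (fun p => p.2 == t) A -> all (fun p => t < p.2) B ->
  open_edges t.+1 ([seq (t, v) | v <- right_nbrs t] ++ B).
Proof.
case=> Lsort Luniq Lmem /allP At /allP Bt.
have BP u v : (u, v) \in B -> [/\ u < t, t < v & e u v].
  move=> uvB; have := Lmem u v; rewrite mem_cat uvB orbT.
  by move/esym/and3P => [ut _ euv]; split=> //; exact: (Bt _ uvB).
split.
- move: Lsort; rewrite !(sorted_pairwise leq_trans) !map_cat !pairwise_cat.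
  case/and3P=> _ _ ->; rewrite andbT -map_comp map_id_in //.
  rewrite -(sorted_pairwise leq_trans) right_nbrs_sorted andbT.
  apply/allrelP => v _ vr /mapP[[u w] /BP[ut tw euw] ->] /=.
  move: vr; rewrite mem_right_nbrs => /andP[tv etv].
  rewrite leqNgt; apply/negP => wv; exact: (e_nc ut tw wv euw etv).
- move: Luniq; rewrite !cat_uniq => /and3P[_ _ ->]; rewrite andbT.
  rewrite map_inj_uniq; last by move=> ? ? [].
  rewrite filter_uniq ?iota_uniq //=.
  apply/hasPn => -[u v] /BP[ut _ _]; apply/mapP => -[w _ [E _]].
  by rewrite E ltnn in ut.
move=> u v; rewrite mem_cat ltnS.
have -> : ((u, v) \in [seq (t, v) | v <- right_nbrs t])
    = [&& u == t, t < v & e t v].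
  apply/mapP/and3P => [[w] |[/eqP-> tv etv]]; last first.
    by exists v => //; rewrite mem_right_nbrs tv.
  by rewrite mem_right_nbrs => /andP[? ?] [-> ->].
case: (ltngtP u t) => [ut|ut|-> /=].
- apply/idP/and3P => [/BP[? ? ?]|[_ tv euv]] //.
  have := Lmem u v; rewrite ut euv (ltnW tv) mem_cat => /orP[/At /eqP /= E|//].
  by rewrite E ltnn in tv.
- by apply/negP => /BP[]; rewrite ltnNge (ltnW ut).
- by case H : ((t, v) \in B); rewrite ?orbF //; case/BP: H; rewrite ltnn.
Qed.

(* With the vertices of each path numbered consecutively by pos, the two open
   edges of a strand leave the interval of positions it occupies in opposite
   directions; this is why they cannot end at the same vertex. *)
Definition strand_ok (x : strand (nat * nat)) : bool :=
  if x is Two (u, v) (u', v') then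
    (pos v < pos u <= pos u') && (pos u' < pos v')
    || (pos v' < pos u' <= pos u) && (pos u < pos v)
  else true.

(** The scan does not know where an open edge will end, so right endpoints are forgotten. *)
Definition left_ends st := map (strand_map (@fst nat nat)) st.

Lemma scans_complete k t st : t + k = n ->
  open_edges t (stack_ends st) -> all strand_ok st ->
  exists2 w, w \in scans k t (left_ends st)
    & forall u v, ((u, v) \in w) = [&& t <= v, u < v & e u v].
Proof.
elim: k t st => [|k IH] t st tk Lt okst.
  exists [::].
    case: st Lt okst => [|x st] // [_ _ Lmem] _; exfalso.
    have [u [v]] : exists u v, (u, v) \in stack_ends (x :: st).
      by case: x Lmem => [[u v]|[u v] p] _; exists u, v; rewrite inE eqxx.
    by rewrite Lmem => /and3P[_ tv /e_lt[]]; lia.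
  by move=> u v; rewrite in_nil; apply/esym/and3P => -[? ? /e_lt[]]; lia.
have [A [B [E At Bt sz]]] := open_edges_split Lt.
have tSk : t.+1 + k = n by lia.
rewrite E in Lt.
(* It remains to exhibit the stack after [t]; the edges [A] closed at [t] are then listed before
   those found later. *)
have next st' : stack_ends st' = [seq (t, v) | v <- right_nbrs t] ++ B ->
    all strand_ok st' ->
    exists2 w, w \in scans k t.+1 (left_ends st')
      & forall u v, ((u, v) \in A ++ w) = [&& t <= v, u < v & e u v].
  move=> E' ok'; have := open_edges_next Lt At Bt; rewrite -E' => Lt'.
  have [w wk ws] := IH _ _ tSk Lt' ok'; exists w => // u v.
  rewrite mem_cat ws; case: Lt => _ _ Lmem.
  have := Lmem u v; rewrite mem_cat.
  case: (ltngtP t v) => [tv|tv|tv] /=.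
  - have -> : (u, v) \in A = false.
      by apply/negP => /(allP At) /= /eqP E2; rewrite E2 ltnn in tv.
    by [].
  - have -> // : (u, v) \in A = false.
    by apply/negP => /(allP At) /= /eqP E2; rewrite E2 ltnn in tv.
  - rewrite !orbF -tv; have -> : (u, t) \in B = false.
      by apply/negP => /(allP Bt) /=; rewrite ltnn.
    by rewrite orbF => ->.
have nbrR v : v \in right_nbrs t -> t < v /\ e t v.
  by rewrite mem_right_nbrs => /andP[].
have nbrL u v : (u, v) \in A -> [/\ v = t, e u t & u < t].
  move=> uvA; case: Lt => _ _ /(_ u v); rewrite mem_cat uvA.
  by move: (allP At _ uvA) => /= /eqP-> /esym/and3P[].
have Runiq : uniq (right_nbrs t) by rewrite filter_uniq ?iota_uniq.
have pos_neq u v : e t u -> e t v -> u != v -> pos u != pos v.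
  move=> /e_lt[_ un] /e_lt[_ vn]; apply: contraNneq => E2; exact/eqP/pos_inj.
(* Cases by the number of edges closed at [t], from three or more down to none, then by the number
   opened. *)
case: A => [|[u x] [|[u' x'] [|? ?]]] in E At sz next nbrL Lt *; last first.
- by [].
- have [? eut ut] := nbrL u x (mem_head _ _); subst x.
  have [? eut' ut'] : [/\ x' = t, e u' t & u' < t].
    by apply: nbrL; rewrite !inE eqxx orbT.
  subst x'; rewrite /= in E sz.
  have R0 : right_nbrs t = [::] by apply/nilP; rewrite /nilp; lia.
  rewrite R0 /= in next.
  case: st E okst => [|[p|p q] st] //=; last first.
    by case=> -> -> _ /andP[/= okpq _]; exfalso; lia.
  case=> ->; case: st => [|[p'|p' q] st] //= [-> EB] okst.
    have [|w ww ws] := next st EB; first by [].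
    exists [:: (u, t), (u', t) & w] => //.
    by rewrite !mem_cat (map_f (cat [:: _; _])) ?orbT.
  have [||w ww ws] := next (One q :: st); rewrite -?EB //.
    by case/andP: okst.
  exists [:: (u, t), (u', t) & w] => //.
  by rewrite !mem_cat (map_f (cat [:: _; _])) ?orbT.
- have [? eut ut] := nbrL u x (mem_head _ _); subst x.
  case: (right_nbrs t) nbrR Runiq sz next => [|v [|//]] nbrR Runiq sz next.
    case: st E okst => [|[p|p q] st] //= [-> EB] okst.
      have [//|//|w ww ws] := next st.
      exists ((u, t) :: w) => //.
      by rewrite !mem_cat (map_f (cons _)) ?orbT // mem_cat ww.
    have [||w ww ws] := next (One q :: st); rewrite -?EB //.
      by case/andP: okst.
    exists ((u, t) :: w) => //.
    by rewrite !mem_cat (map_f (cons _)) ?orbT // mem_cat ww.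
  have [tv etv] := nbrR v (mem_head _ _).
  case: st E okst => [|[p|p q] st] //= [-> EB] okst.
    have [||w ww ws] := next (One (t, v) :: st); rewrite -?EB //.
    exists ((u, t) :: w) => //.
    by rewrite !mem_cat (map_f (cons _)) ?orbT // mem_cat ww orbT.
  (* The path reaches [t] from [u] and leaves to [v]. These lie on opposite sides of [t] in the
     numbering, so its interval of positions grows by [t] and [strand_ok] persists. *)
  have vu : v != u by rewrite gtn_eqF // (ltn_trans ut tv).
  have [||w ww ws] := next (Two (t, v) q :: st); rewrite -?EB //.
    case/andP: okst => okq okr; rewrite /= okr andbT.
    case: q EB okq => q1 q2 EB /=.
    have := pos_neq _ _ etv _ vu; rewrite e_sym eut => /(_ isT).
    by move: (e_pos etv) (e_pos eut); lia.
  exists ((u, t) :: w) => //.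
  by rewrite !mem_cat (map_f (cons _)) ?orbT // mem_cat ww orbT.
- rewrite /= in E.
  case: (right_nbrs t) nbrR Runiq sz next => [|v [|v' [|//]]] nbrR Runiq sz next.
  + have [||w ww ws] := next st => //.
    by exists w; rewrite // !mem_cat ww.
  + have [||w ww ws] := next (One (t, v) :: st) => //=; first by rewrite -E.
    by exists w; rewrite // !mem_cat ww orbT.
  + have [||w ww ws] := next (Two (t, v) (t, v') :: st) => //=.
    * by rewrite -E.
    * rewrite okst andbT.
      have [tv etv] := nbrR v (mem_head _ _).
      have [_ etv'] : t < v' /\ e t v' by apply: nbrR; rewrite !inE eqxx orbT.
      have vv' : v != v' by move: Runiq; rewrite /= inE andbT.
      have := pos_neq _ _ etv etv' vv'.
      by move: (e_pos etv) (e_pos etv'); lia.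
    by exists w; rewrite // !mem_cat ww !orbT.
Qed.

End Scan.

Local Open Scope ring_scope.

(** * Exponential bound on the number of scans *)

Section Potential.
Variables (R : realFieldType) (a b c : R).
Hypotheses (a_ge0 : 0 <= a) (b_ge0 : 0 <= b) (c_ge : 1 + a + a ^+ 2 <= c).
(** If [potential r] is (v, w), the left-hand sides of [ca_ge] and [cb_ge] are the coefficients of v
    and w in the total potential of the successors of [One _ :: r]. A top [Two] uses the first
    inequality again, and the empty stack uses [c_ge]. *)
Hypothesis ca_ge : 2 * a + (1 + a) * (a ^+ 2 + b) + 1 <= c * a.
Hypothesis cb_ge : 2 * b + (1 + a) * a * b + 1 <= c * b.

(* The first component bounds the number of completions of a stack, the second
   one the number of completions once its top open edge has been closed by a
   vertex that also closes an edge above it. *)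
Fixpoint potential (st : seq (strand nat)) : R * R :=
  match st with
  | [::] => (1, 0)
  | One _ :: r => let: (v, w) := potential r in (a * v + b * w, v)
  | Two _ _ :: r => let: (v, w) := potential r in
                    (a * (a * v + b * w), a * v + b * w)
  end.

Lemma potential_ge0 st : 0 <= (potential st).1 /\ 0 <= (potential st).2.
Proof.
elim: st => [|[x|x y] r] /=; first by split.
all: case: (potential r) => v w /= [v0 w0].
all: have H : 0 <= a * v + b * w by rewrite addr_ge0 ?mulr_ge0.
all: by split => //; rewrite mulr_ge0.
Qed.

Lemma size_scans k t st :
  (size (scans k t st))%:R <= c ^+ k * (potential st).1.
Proof.
have c_ge0 : 0 <= c by apply: le_trans c_ge; rewrite !addr_ge0 ?exprn_ge0.
elim: k t st => [|k IH] t st.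
  rewrite expr0 mul1r; case: st => [|x r] //=.
  exact: (potential_ge0 (x :: r)).1.
have ck_ge0 : 0 <= c ^+ k by rewrite exprn_ge0.
rewrite exprSr -mulrA.
pose sz st' : R := (size (scans k t.+1 st'))%:R.
have {}IH st' : sz st' <= c ^+ k * (potential st').1 by exact: IH.
(* With [l] the list of successor stacks, the bound reduces to one step: their potentials sum to at
   most [c] times the current one. *)
have step (l : seq (seq (strand nat))) :
    \sum_(x <- l) (potential x).1 <= c * (potential st).1 ->
    \sum_(x <- l) sz x <= c ^+ k * (c * (potential st).1).
  move=> H; apply: le_trans (ler_wpM2l ck_ge0 H).
  by rewrite mulr_sumr; apply: ler_sum => x _.
have [v0 w0] := potential_ge0 (behead st).
case: st step v0 w0 => [|[u|u1 u2] r] step /= v0 w0.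
- apply: le_trans (step [:: [::]; [:: One t]; [:: Two t t]] _).
    by rewrite !size_cat !natrD !big_cons big_nil /sz /= !addr0.
  by rewrite !big_cons big_nil /=; move: c_ge; rewrite expr2; lra.
- case: r step v0 w0 => [|[u'|u1 u2] r] step v0 w0.
  + apply: le_trans (step [:: [:: One u]; [:: One t; One u];
      [:: Two t t; One u]; [::]; [:: One t]] _).
      rewrite !(size_cat, size_map) !natrD !big_cons big_nil /sz /=.
      by rewrite !addr0 -?addrA lexx.
    by rewrite !big_cons big_nil /=; move: ca_ge cb_ge; nra.
  + apply: le_trans (step [:: [:: One u, One u' & r];
      [:: One t, One u, One u' & r]; [:: Two t t, One u, One u' & r];
      One u' :: r; [:: One t, One u' & r]; r] _).
      rewrite !(size_cat, size_map) !natrD !big_cons big_nil /sz /=.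
      by rewrite !addr0 -?addrA lexx.
    rewrite !big_cons big_nil /=; move: v0 w0 => /=.
    case: (potential r) => v w /= v0 w0.
    have := ler_wpM2r v0 ca_ge; have := ler_wpM2r w0 cb_ge.
    set V := a * v + b * w in v0 *. lra.
  + apply: le_trans (step [:: [:: One u, Two u1 u2 & r];
      [:: One t, One u, Two u1 u2 & r]; [:: Two t t, One u, Two u1 u2 & r];
      Two u1 u2 :: r; [:: One t, Two u1 u2 & r]; One u2 :: r] _).
      rewrite !(size_cat, size_map) !natrD !big_cons big_nil /sz /=.
      by rewrite !addr0 -?addrA lexx.
    rewrite !big_cons big_nil /=; move: v0 w0 => /=.
    case: (potential r) => v w /= v0 w0.
    have := ler_wpM2r v0 ca_ge; have := ler_wpM2r w0 cb_ge.
    set V := a * v + b * w in v0 w0 *. lra.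
- apply: le_trans (step [:: Two u1 u2 :: r; [:: One t, Two u1 u2 & r];
     [:: Two t t, Two u1 u2 & r]; One u2 :: r; Two t u2 :: r] _).
    rewrite !(size_cat, size_map) !natrD !big_cons big_nil /sz /=.
    by rewrite !addr0 -?addrA lexx.
  rewrite !big_cons big_nil /=.
  case: (potential r) v0 w0 => v w /= v0 w0.
  have V0 : 0 <= a * v + b * w by rewrite addr_ge0 ?mulr_ge0.
  have := ler_wpM2r V0 ca_ge.
  set V := a * v + b * w. lra.
Qed.

End Potential.

(** * Orientations and the circular order of points in convex position *)

Definition orient (R : realType) (p q r : R * R) : R :=
  (q.1 - p.1) * (r.2 - p.2) - (q.2 - p.2) * (r.1 - p.1).

Definition lexlt (R : realType) (p q : R * R) : bool :=
  (p.1 < q.1) || (p.1 == q.1) && (p.2 < q.2).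

Lemma lexltE (R : realType) (p q : R * R) : lexlt p q =
  (0 < q.1 - p.1) || (q.1 - p.1 == 0) && (0 < q.2 - p.2).
Proof. by rewrite /lexlt !subr_gt0 subr_eq0 eq_sym. Qed.

(** The points after [o] lexicographically lie in a half-plane at [o], closed on one boundary ray
    only, where comparing angles is transitive. Vertical directions are treated apart. *)
Lemma orient_trans (R : realType) (o p q r : R * R) :
  lexlt o p -> lexlt o q -> lexlt o r ->
  0 < orient o p q -> 0 < orient o q r -> 0 < orient o p r.
Proof.
rewrite !lexltE /orient; case: o p q r => [o1 o2] [p1 p2] [q1 q2] [r1 r2] /=.
move: (p1 - o1) (p2 - o2) (q1 - o1) (q2 - o2) (r1 - o1) (r2 - o2).
move=> a1 a2 b1 b2 c1 c2 Ha Hb Hc Hab Hbc.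
have a1ge : 0 <= a1 by case/orP: Ha => [|/andP[/eqP->]] //; exact: ltW.
have c1ge : 0 <= c1 by case/orP: Hc => [|/andP[/eqP->]] //; exact: ltW.
case/orP: Hb => [b1gt|/andP[/eqP b10 b2gt]]; last first.
  by move: Hbc; rewrite b10; nra.
rewrite -(pmulr_rgt0 _ b1gt).
have -> : b1 * (a1 * c2 - a2 * c1)
   = c1 * (a1 * b2 - a2 * b1) + a1 * (b1 * c2 - b2 * c1) by ring.
case/orP: Ha => [a1gt|/andP[/eqP a10 a2gt]].
  by rewrite ltr_wpDl ?mulr_gt0 // mulr_ge0 // ltW.
by move: Hab; rewrite a10; nra.
Qed.

Section Convex.
Variables (R : realType) (n : nat) (P : 'I_n -> R * R).
Hypotheses (injP : injective P) (convP : convex_position P).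

(** The points [j], [k], [l] may coincide, so this covers segments as well as triangles. *)
Lemma not_convex_comb (i j k l : 'I_n) (a b c : R) :
  j != i -> k != i -> l != i -> 0 <= a -> 0 <= b -> 0 <= c -> a + b + c = 1 ->
  a * (P j).1 + b * (P k).1 + c * (P l).1 = (P i).1 ->
  a * (P j).2 + b * (P k).2 + c * (P l).2 = (P i).2 -> False.
Proof.
move=> ji ki li a0 b0 c0 abc H1 H2; apply: (convP (i := i)).
have sum1 (x : R) m f : \sum_h x * (h == m)%:R * f h = x * f m.
  rewrite (bigD1 m) //= eqxx mulr1 big1 ?addr0 // => h /negPf ->.
  by rewrite mulr0 mul0r.
pose w h : R := a * (h == j)%:R + b * (h == k)%:R + c * (h == l)%:R.
have sumw f : \sum_h w h * f h = a * f j + b * f k + c * f l.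
  by under eq_bigr do rewrite 2!mulrDl; rewrite !big_split /= !sum1.
exists w; split; last split; last split; last split.
- by move=> h; rewrite !addr_ge0 // mulr_ge0.
- rewrite /w ![i == _]eq_sym (negPf ji) (negPf ki) (negPf li).
  by rewrite !mulr0 !addr0.
- have := sumw (fun=> 1); rewrite !mulr1 abc => <-.
  by apply: eq_bigr => h _; rewrite mulr1.
- by rewrite sumw.
- by rewrite sumw.
Qed.

(** If collinear with [o], both points would lie on one ray from [o], and the nearer one would be on
    the segment from [o] to the farther one. *)
Lemma orient_neq0 (o i j : 'I_n) : i != j ->
  lexlt (P o) (P i) -> lexlt (P o) (P j) -> orient (P o) (P i) (P j) != 0.
Proof.
move=> ij Hi Hj; apply/eqP => Ho.
have lexlt_neq k : lexlt (P o) (P k) -> o != k.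
  by apply: contraTN => /eqP <-; rewrite /lexlt !ltxx eqxx.
have btw k l (t : R) : lexlt (P o) (P k) -> k != l -> 0 <= t <= 1 ->
    (P k).1 - (P o).1 = t * ((P l).1 - (P o).1) ->
    (P k).2 - (P o).2 = t * ((P l).2 - (P o).2) -> False.
  move=> Hk kl /andP[t0 t1] E1 E2.
  apply: (@not_convex_comb k o l l (1 - t) t 0).
  - exact: lexlt_neq.
  - by rewrite eq_sym.
  - by rewrite eq_sym.
  - lra.
  - lra.
  - lra.
  - lra.
  - lra.
  - lra.
have colin k l : lexlt (P o) (P k) -> lexlt (P o) (P l) -> k != l ->
    orient (P o) (P k) (P l) = 0 ->
    ((P k).1 - (P o).1 <= (P l).1 - (P o).1) ->
    ((P k).2 - (P o).2 <= (P l).2 - (P o).2) \/ 0 < (P k).1 - (P o).1 -> False.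
  rewrite /orient => Hk Hl kl H0 H1 H2.
  move: (Hk) (Hl); rewrite !lexltE.
  move: (@btw k l) H0 H1 H2; move: ((P k).1 - (P o).1) ((P k).2 - (P o).2)
    ((P l).1 - (P o).1) ((P l).2 - (P o).2) => a1 a2 b1 b2 B H0 H1 H2 Ha Hb.
  (* The ratio of distances from [o] is read off the first coordinates, or off the second ones on a
     vertical line. *)
  have [a1gt|a1le] := ltP 0 a1.
    have b1gt : 0 < b1 by lra.
    apply: (B (a1 / b1)) => //.
    + by rewrite divr_ge0 ?ler_pdivrMr ?mul1r ?H1 // ltW.
    + by rewrite divfK // gt_eqF.
    + by rewrite mulrAC (_ : a1 * b2 = a2 * b1) ?mulfK ?gt_eqF //; lra.
  case: H2 => [H2|]; last by rewrite ltNge a1le.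
  move: Ha; rewrite ltNge a1le /= => /andP[/eqP a10 a2gt].
  move: H0; rewrite a10 mul0r sub0r => /eqP; rewrite oppr_eq0 mulf_eq0 gt_eqF //=.
  move=> /eqP b10; move: Hb; rewrite b10 ltxx eqxx /= => b2gt.
  apply: (B (a2 / b2)) => //.
  - by rewrite divr_ge0 ?ler_pdivrMr ?mul1r ?H2 // ltW.
  - by rewrite a10 b10 mulr0.
  - by rewrite divfK // gt_eqF.
have Ho' : orient (P o) (P j) (P i) = 0 by move: Ho; rewrite /orient; lra.
have ji : j != i by rewrite eq_sym.
have [Hlt|Hlt|Heq] := ltgtP (P i).1 (P j).1.
- have [Hi0|Hi0] := ltP 0 ((P i).1 - (P o).1).
    by apply: (colin i j) => //; [lra | right].
  move: Ho Hi; rewrite /orient /lexlt => Ho.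
  by case/orP=> [|/andP[/eqP E Hi]]; [lra | nra].
- have [Hi0|Hi0] := ltP 0 ((P j).1 - (P o).1).
    by apply: (colin j i) => //; [lra | right].
  move: Ho Hj; rewrite /orient /lexlt => Ho.
  by case/orP=> [|/andP[/eqP E Hj]]; [lra | nra].
- have [H|H] := leP (P i).2 (P j).2.
    by apply: (colin i j) => //; [lra | left; lra].
  by apply: (colin j i) => //; [lra | left; lra].
Qed.

(** Otherwise [j] would lie in the triangle [o], [i], [k]; the ratios of areas [a] and [b] are its
    barycentric coordinates at [i] and [k]. *)
Lemma orient_fan (o i j k : 'I_n) : o != j -> i != j -> k != j ->
  0 < orient (P o) (P i) (P j) -> 0 < orient (P o) (P j) (P k) ->
  0 < orient (P o) (P i) (P k) -> 0 < orient (P i) (P j) (P k).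
Proof.
move=> oj ij kj Hij Hjk Hik.
have E : orient (P i) (P j) (P k) = orient (P o) (P i) (P j)
    + orient (P o) (P j) (P k) - orient (P o) (P i) (P k).
  by rewrite /orient; ring.
rewrite E subr_gt0 ltNge; apply/negP => le.
pose a := orient (P o) (P j) (P k) / orient (P o) (P i) (P k).
pose b := orient (P o) (P i) (P j) / orient (P o) (P i) (P k).
have ab : a + b <= 1 by rewrite /a /b -mulrDl ler_pdivrMr // mul1r addrC.
have nz := lt0r_neq0 Hik.
apply: (@not_convex_comb j o i k (1 - a - b) a b) => //.
- lra.
- by rewrite divr_ge0 // ltW.
- by rewrite divr_ge0 // ltW.
- lra.
- by move: nz; rewrite /a /b /orient => nz; field.
- by move: nz; rewrite /a /b /orient => nz; field.
Qed.

(** The diagonals of a convex quadrilateral meet. [A] is twice its area, computed from either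
    diagonal, and [t], [s] locate the intersection on the diagonals by Cramer's rule. *)
Lemma orient_cross (i j k l : 'I_n) :
  [set i; k] :&: [set j; l] = set0 ->
  0 < orient (P i) (P j) (P k) -> 0 < orient (P i) (P k) (P l) ->
  0 < orient (P i) (P j) (P l) -> 0 < orient (P j) (P k) (P l) ->
  edges_cross P i k j l.
Proof.
move=> dis Hijk Hikl Hijl Hjkl.
pose A := orient (P i) (P j) (P l) + orient (P j) (P k) (P l).
have A0 : 0 < A by rewrite addr_gt0.
have EA : A = orient (P i) (P j) (P k) + orient (P i) (P k) (P l).
  by rewrite /A /orient; ring.
pose t := orient (P i) (P j) (P l) / A.
pose s := orient (P i) (P j) (P k) / A.
exists ((1 - t) * (P i).1 + t * (P k).1, (1 - t) * (P i).2 + t * (P k).2).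
split; last split.
- exists t; split=> //.
  by rewrite divr_ge0 ?ler_pdivrMr // ?mul1r ?lerDl ltW.
- exists s; split.
    by rewrite divr_ge0 ?ler_pdivrMr // ?mul1r ?EA ?lerDl ltW // -EA.
  have := lt0r_neq0 A0; rewrite /t /s /A /orient => nz.
  by congr pair; field.
- by case=> v []; rewrite dis inE.
Qed.

Lemma convex_circular_order : exists s : seq 'I_n, perm_eq s (enum 'I_n) /\
  forall x0 a b c d, (a < b)%N -> (b < c)%N -> (c < d)%N -> (d < n)%N ->
    edges_cross P (nth x0 s a) (nth x0 s c) (nth x0 s b) (nth x0 s d).
Proof.
have [o0|no] := pickP (fun _ : 'I_n => true); last first.
  by exists (enum 'I_n); split=> // x0; have := no x0.
move=> _.
(* Seen from the lexicographic minimum [o], the other points lie in a half-plane, which makes the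
   angular order [r] total and transitive on them. *)
have [o lexo] : exists o, forall i, i != o -> lexlt (P o) (P i).
  case: (Order.TotalTheory.arg_minP (fun i => (P i).1) (i0 := o0) (P := xpredT)) => // m _ Hm.
  case: (Order.TotalTheory.arg_minP (fun i => (P i).2) (i0 := m)
    (P := fun i => (P i).1 == (P m).1)) => // o /eqP om Ho.
  exists o => i io; rewrite /lexlt om.
  have := Hm i isT; rewrite le_eqVlt => /orP[/eqP E|->//].
  rewrite E eqxx /= orbC lt_neqAle Ho ?E ?eqxx // andbT.
  case: eqP => //= E2; case/eqP: io; apply: injP.
  by rewrite [LHS]surjective_pairing [RHS]surjective_pairing om E E2.
pose r i j := (i == j) || (0 < orient (P o) (P i) (P j)).
pose D := [pred i | i != o].
pose s' := sort r [seq i <- enum 'I_n | i != o].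
have s'D : all D s' by rewrite all_sort filter_all.
have totr : {in D &, total r}.
  move=> i j iD jD; rewrite /r; case: eqVneq => //= ij.
  have := orient_neq0 ij (lexo _ iD) (lexo _ jD).
  rewrite neq_lt => /orP[H|->//]; apply/orP; right.
  by move: H; rewrite /orient => H; lra.
have trr : {in D & &, transitive r}.
  move=> j i k jD iD kD; rewrite /r => /orP[/eqP->//|Hij].
  case/orP=> [/eqP<-|Hjk]; first by rewrite Hij orbT.
  by rewrite (orient_trans (q := P j)) ?orbT ?lexo.
have s'uniq : uniq s' by rewrite sort_uniq filter_uniq ?enum_uniq.
have os' : o \notin s' by rewrite mem_sort mem_filter eqxx.
have perm : perm_eq (o :: s') (enum 'I_n).
  apply: uniq_perm; rewrite ?enum_uniq //= ?os' //.
  by move=> i; rewrite inE mem_sort mem_filter mem_enum inE andbT; case: eqP.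
have sz : size (o :: s') = n by rewrite (perm_size perm) size_enum_ord.
exists (o :: s'); split=> // x0.
have fan a b : (0 < a)%N -> (a < b)%N -> (b < n)%N ->
    0 < orient (P o) (P (nth x0 (o :: s') a)) (P (nth x0 (o :: s') b)).
  case: a b => [|a] // [|b] // _ /= ab bn; rewrite ltnS in ab.
  have bs : (b < size s')%N by rewrite -ltnS -[X in (_ < X)%N]/(size (o :: s')) sz.
  have as' : (a < size s')%N by apply: ltn_trans bs.
  have : pairwise r s'.
    rewrite -(sorted_pairwise_in trr) //.
    by apply: (sort_sorted_in totr); rewrite filter_all.
  move/(pairwiseP x0) => /(_ a b as' bs ab).
  by rewrite /r nth_uniq // (ltn_eqF ab).
have neq a b : (a < b)%N -> (b < n)%N ->
    nth x0 (o :: s') a != nth x0 (o :: s') b.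
  move=> ab bn; rewrite nth_uniq ?sz ?(ltn_eqF ab) ?(ltn_trans ab) //.
  by rewrite /= os'.
(* Every increasing triple turns counterclockwise: by sorting if it starts at [o], by [orient_fan]
   otherwise. *)
have tri a b c : (a < b)%N -> (b < c)%N -> (c < n)%N ->
    0 < orient (P (nth x0 (o :: s') a)) (P (nth x0 (o :: s') b))
               (P (nth x0 (o :: s') c)).
  move=> ab bc cn; have bn := ltn_trans bc cn.
  have [a0|a0] := posnP a; first by rewrite a0; apply: fan => //; rewrite -a0.
  have b0 := ltn_trans a0 ab; have ac := ltn_trans ab bc.
  have ob := neq 0%N b b0 bn.
  apply: (@orient_fan o _ _ _ ob) => //.
  - exact: neq.
  - by rewrite eq_sym neq.
  - exact: fan.
  - exact: fan.
  - exact: fan.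
move=> a b c d ab bc cd dn.
have cn := ltn_trans cd dn.
apply: orient_cross; last first.
- by apply: tri.
- by apply: tri => //; exact: ltn_trans bc cd.
- by apply: tri => //; exact: ltn_trans ab bc.
- by apply: tri.
apply/setP => x; rewrite !inE; apply/negbTE/negP.
have bn := ltn_trans bc cn.
have N1 := neq a b ab bn; have N2 := neq b c bc cn; have N3 := neq c d cd dn.
have N4 := neq a d (ltn_trans (ltn_trans ab bc) cd) dn.
case/andP=> /orP[]/eqP-> /orP[]/eqP E.
- by rewrite E eqxx in N1.
- by rewrite E eqxx in N4.
- by rewrite E eqxx in N2.
- by rewrite E eqxx in N3.
Qed.

End Convex.

(** * From path partitions to scans *)

Lemma index_consecutive (T : eqType) (x y : T) (s1 s2 : seq T) :
  uniq (s1 ++ x :: y :: s2) ->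
  index y (s1 ++ x :: y :: s2) = (index x (s1 ++ x :: y :: s2)).+1.
Proof.
rewrite cat_uniq /= !inE !negb_or => /and3P[_ /and3P[xs1 ys1 _]].
move=> /andP[/andP[xy _] _].
by rewrite !index_cat (negPf xs1) (negPf ys1) /= !eqxx (negPf xy) addn0 addn1.
Qed.

(** A vertex is numbered by its index in the concatenation of all paths. Ends of different paths may
    get consecutive numbers, which the conclusion allows. *)
Lemma path_partition_graph_pos n (E : {set {set 'I_n}}) :
  path_partition_graph E -> exists2 pos : 'I_n -> nat, injective pos &
    forall x y, [set x; y] \in E -> pos x = (pos y).+1 \/ pos y = (pos x).+1.
Proof.
case=> ss [perm HE].
have Fu : uniq (flatten ss) by rewrite (perm_uniq perm) enum_uniq.
have Fin x : x \in flatten ss by rewrite (perm_mem perm) mem_enum.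
exists (index^~ (flatten ss)).
  by move=> x y E2; rewrite -[x](nth_index x (Fin x)) E2 nth_index.
move=> x y /HE[s sss [a [b [s1 [s2 [Es Exy]]]]]].
have [l1 [l2 El]] : exists l1 l2, flatten ss = l1 ++ s ++ l2.
  case/splitPr: sss => ss1 ss2; exists (flatten ss1), (flatten ss2).
  by rewrite flatten_cat.
have Eab : index b (flatten ss) = (index a (flatten ss)).+1.
  have EF : flatten ss = (l1 ++ s1) ++ a :: b :: (s2 ++ l2).
    by rewrite El Es -!catA.
  by rewrite EF index_consecutive // -EF.
have [xab yab] : x \in [set a; b] /\ y \in [set a; b].
  by rewrite -Exy !inE !eqxx orbT.
have [axy bxy] : a \in [set x; y] /\ b \in [set x; y].
  by rewrite Exy !inE !eqxx orbT.
have ab : a != b by apply: contra_eq_neq Eab => ->; lia.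
move: xab yab axy bxy; rewrite !inE.
case/orP=> /eqP->; case/orP=> /eqP->; rewrite ?eqxx ?(negPf ab) ?(eq_sym b) ?(negPf ab) //=; auto.
Qed.

(** Every ncp partition is the graph of some scanned edge list, with vertices renamed along the
    circular order. *)
Lemma num_ncp_le_scans (R : realType) n (P : 'I_n -> R * R) :
  injective P -> convex_position P -> (num_ncp P <= size (scans n 0 [::]))%N.
Proof.
case: n P => [|n] P injP convP.
  apply: (@leq_trans #|[set set0 : {set {set 'I_0}}]|); last by rewrite cards1.
  apply: subset_leq_card; apply/subsetP => E; rewrite !inE => /asboolP[_ [ss [_ HE]]].
  by apply/eqP/setP => f; rewrite inE; apply/negP => /HE[? _ [[]]].
have [s [perm cross]] := convex_circular_order injP convP.
have su : uniq s by rewrite (perm_uniq perm) enum_uniq.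
have sz : size s = n.+1 by rewrite (perm_size perm) size_enum_ord.
have smem x : x \in s by rewrite (perm_mem perm) mem_enum.
pose p := nth ord0 s.
pose graph (w : seq (nat * nat)) := [set e | has (fun uv => e == [set p uv.1; p uv.2]) w].
rewrite /num_ncp cardE -(size_map graph).
apply: uniq_leq_size; first exact: enum_uniq.
move=> E; rewrite mem_enum inE => /asboolP[nc path].
have [ss [_ edgeE]] := path; have [pos pos_inj posE] := path_partition_graph_pos path.
pose e u v := [&& u < n.+1, v < n.+1 & [set p u; p v] \in E]%N.
have [||||||||w ww ws] := @scans_complete n.+1 e (pos \o p) _ _ _ _ _ n.+1 0 [::].
- by move=> u v /and3P[].
- by move=> u v; rewrite /e setUC andbCA.
- by move=> u v /and3P[_ _ /posE].
- move=> u v un vn /= /pos_inj /eqP; rewrite nth_uniq ?sz // => /eqP //.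
- move=> a b c d ab bc cd /and3P[_ _ ac] /and3P[_ dn bd].
  apply: (nc _ _ _ _ ac bd); last exact: cross.
  apply/eqP => Eq; have : p a \in [set p b; p d] by rewrite -Eq !inE eqxx.
  by rewrite !inE !nth_uniq ?sz //; lia.
- by [].
- by split=> // u v; rewrite in_nil.
- by [].
apply/mapP; exists w => //.
have edge u v : e u v -> u != v.
  by move=> /and3P[_ _ /posE E1]; apply/eqP => uv; rewrite uv in E1; lia.
(* [w] lists an edge only with its smaller endpoint first. *)
have mem_w u v : e u v -> [set p u; p v] \in graph w.
  move=> euv; rewrite inE; apply/hasP.
  have := edge _ _ euv; rewrite neq_ltn => /orP[uv|vu].
    by exists (u, v); rewrite //= ws uv.
  exists (v, u); last by rewrite /= setUC.
  by rewrite ws vu; move: euv; rewrite /e (setUC [set p v]) => /and3P[-> -> ->].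
apply/setP => f; apply/idP/idP => [fE|]; last first.
  rewrite inE => /hasP[[u v] uvw /eqP-> /=].
  by move: uvw; rewrite ws => /and3P[_ _ /and3P[]].
have /edgeE[s0 _ [x [y [s1 [s2 [_ fxy]]]]]] := fE.
have pi z : p (index z s) = z by rewrite /p nth_index.
have lt z : (index z s < n.+1)%N by rewrite -[X in (_ < X)%N]sz index_mem.
rewrite fxy -(pi x) -(pi y); apply: mem_w.
by rewrite /e !pi -fxy fE !lt.
Qed.

(* O^*(c^n) with c = 5.610718614: bounded by C * (n+1)^k * c^n *)
Theorem theorem1 (R : realType) :
  exists (C : R) (k : nat), forall (n : nat) (P : 'I_n -> R * R),
    injective P -> convex_position P ->
    (num_ncp P)%:R <= C * (n.+1)%:R ^+ k * ((5610718614%:R / (10 ^ 9)%:R : R) ^+ n).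
Proof.
(* The empty stack has potential 1, so the bound is [c ^+ n] with no polynomial factor. *)
exists 1, 0%N => n P injP convP; rewrite expr0 !mul1r.
set c : R := _ / _.
(* (a, b) is the double root that the two equations c * a = ... and
   c * b = ... of size_scans have at the critical rate 5.6107186132..., rounded
   to 9 digits; the slack in c is about 7e-10, so fewer digits do not suffice *)
pose a : R := 657298107%:R / 10 ^+ 9.
pose b : R := 396608253%:R / 10 ^+ 9.
have cE : c = 5610718614%:R / 10 ^+ 9.
  have E9 : (10 ^ 9)%:R = 10 ^+ 9 :> R by exact: natrX.
  by rewrite -E9.
have a0 : 0 <= a by rewrite /a; lra.
have b0 : 0 <= b by rewrite /b; lra.
have H1 : 1 + a + a ^+ 2 <= c by rewrite cE /a; lra.
have H2 : 2 * a + (1 + a) * (a ^+ 2 + b) + 1 <= c * a by rewrite cE /a /b; lra.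
have H3 : 2 * b + (1 + a) * a * b + 1 <= c * b by rewrite cE /a /b; lra.
have := size_scans a0 b0 H1 H2 H3 n 0 [::]; rewrite /= mulr1.
by apply: le_trans; rewrite ler_nat num_ncp_le_scans.
Qed.
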